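(* Let $\alpha,\beta,\gamma,\delta\in(0,\pi)$ with $\alpha=\pi-\beta=\gamma=\pi-\delta\neq\pi/2$ (a ''cross''). Then the configuration space of the spherical 4-bar linkage with sector angles $\alpha,\beta,\gamma,\delta$ is the union of the following three branches, each diffeomorphic to a circle $S^1$: $$\{(x,y,z,w)=(t,0,t,0)\},\quad \{(0,t,0,t)\},\quad \Big\{\Big(t,-\frac{1}{t\cos\alpha},-t,\frac{1}{t\cos\alpha}\Big)\Big\},\qquad t\in\mathbb{R}\cup\{\infty\}.$$
   Context: A configuration of the spherical 4-bar linkage (degree-4 single-vertex rigid origami) with sector angles $\alpha,\beta,\gamma,\delta\in(0,\pi)$ is a quadruple of folding angles $(\rho_x,\rho_y,\rho_z,\rho_w)\in(\mathbb{R}/2\pi\mathbb{Z})^4$ satisfying the closure condition $$R_3(\alpha)R_1(\rho_x)R_3(\beta)R_1(\rho_y)R_3(\gamma)R_1(\rho_z)R_3(\delta)R_1(\rho_w)=I,$$ where $R_1(\theta),R_3(\theta)\in SO(3)$ are the rotations by $\theta$ about the first and third coordinate axes. (Panel $\alpha$ lies between creases $w$ and $x$, $\beta$ between $x$ and $y$, $\gamma$ between $y$ and $z$, $\delta$ between $z$ and $w$.) Configurations are recorded by $x=\tan(\rho_x/2)$, $y=\tan(\rho_y/2)$, $z=\tan(\rho_z/2)$, $w=\tan(\rho_w/2)$ in $\mathbb{R}\cup\{\infty\}$, the one-point compactification (a folding angle $\pi$ corresponds to $\infty$; $-\infty$ and $\infty$ are identified), which is identified as a smooth manifold with the circle $\mathbb{R}/2\pi\mathbb{Z}$.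 The configuration space is the set of all such $(x,y,z,w)\in(\mathbb{R}\cup\{\infty\})^4$. For $c\neq0$ real, $c/0=\infty$ and $c/\infty=0$. *)

(* Defs.v *)
From HB Require Import structures.
From mathcomp Require Import all_boot all_order all_algebra.
From mathcomp Require Import all_classical all_reals all_analysis.
From mathcomp Require Import ring lra.
Set Implicit Arguments.
Unset Strict Implicit.
Unset Printing Implicit Defensive.
Import Order.TTheory GRing.Theory Num.Theory.
Import numFieldNormedType.Exports.

Local Open Scope classical_set_scope.
Local Open Scope ring_scope.

(** * Folding angles and the extended line *)

Notation ext_line R := (one_point_compactification R).
Notation ext_line4 R := (ext_line R * ext_line R * ext_line R * ext_line R)%type.

Section ExtendedLine.
Variable R : realType.
Implicit Types (c t theta : R) (u : ext_line R).

(* [cos (theta / 2) = 0] exactly when [theta] is pi modulo [2 * pi]; the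
   library's [tan] would return the junk value [0] there. *)
Definition tan_half theta : ext_line R :=
  if cos (theta / 2) == 0 then None else Some (tan (theta / 2)).

(* The representative in ]-pi, pi] of the class modulo [2 * pi] sent to [u] by
   [tan_half]; see [fold_angleK] and [circle_pt_tan_half]. *)
Definition fold_angle u : R := if u is Some t then 2 * atan t else pi.

(* [c * u], [- u] and [c / u], used for [c != 0] only *)
Definition ext_scale c u : ext_line R := omap ( *%R c) u.

Definition ext_opp u : ext_line R := omap -%R u.

Definition ext_div c u : ext_line R :=
  if u is Some t then (if t == 0 then None else Some (c / t)) else Some 0.

(** * The configuration space *)

Definition rot1 theta : 'M[R]_3 :=
  \matrix_(i < 3, j < 3)
    nth 0 (nth [::] [:: [:: 1; 0; 0];
                        [:: 0; cos theta; - sin theta];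
                        [:: 0; sin theta; cos theta]] i) j.

Definition rot3 theta : 'M[R]_3 :=
  \matrix_(i < 3, j < 3)
    nth 0 (nth [::] [:: [:: cos theta; - sin theta; 0];
                        [:: sin theta; cos theta; 0];
                        [:: 0; 0; 1]] i) j.

Definition closure_condition (alpha beta gamma delta rx ry rz rw : R) : Prop :=
  rot3 alpha *m rot1 rx *m rot3 beta *m rot1 ry *m
  rot3 gamma *m rot1 rz *m rot3 delta *m rot1 rw = 1%:M.

(* The closure condition is [2 * pi]-periodic in the folding angles, so real
   representatives of the classes modulo [2 * pi] suffice. *)
Definition config_space (alpha beta gamma delta : R) : set (ext_line4 R) :=
  [set p | exists rx ry rz rw : R,
     closure_condition alpha beta gamma delta rx ry rz rw /\
     p = (tan_half rx, tan_half ry, tan_half rz, tan_half rw)].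

Definition branch1 : set (ext_line4 R) :=
  [set p | exists t : ext_line R, p = (t, Some 0, t, Some 0)].

Definition branch2 : set (ext_line4 R) :=
  [set p | exists t : ext_line R, p = (Some 0, t, Some 0, t)].

Definition branch3 (alpha : R) : set (ext_line4 R) :=
  [set p | exists t : ext_line R,
     p = (t, ext_div (-1) (ext_scale (cos alpha) t),
          ext_opp t, ext_div 1 (ext_scale (cos alpha) t))].

End ExtendedLine.

Arguments branch1 R : clear implicits.
Arguments branch2 R : clear implicits.

(** * Smooth maps and diffeomorphisms between subsets of Euclidean spaces *)

(* For [U] open in a finite-dimensional [V], [Ck_on k U f] says that [f] is of
   class C^k on [U]. *)
Fixpoint Ck_on (R : realType) (V W : normedModType R) (k : nat) (U : set V)
    (f : V -> W) : Prop :=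
  match k with
  | 0%N => forall x, U x -> {for x, continuous f}
  | k'.+1 => (forall x, U x -> differentiable f x) /\
             (forall v : V, Ck_on k' U (fun x => 'D_v f x))
  end.

Definition smooth_on (R : realType) (V W : normedModType R) (U : set V)
    (f : V -> W) : Prop :=
  forall k : nat, Ck_on k U f.

(* A map on an arbitrary subset [A] is smooth if near each point of [A] it
   extends to a smooth map on an open set of the ambient space. *)
Definition smooth_on_subset (R : realType) (V W : normedModType R) (A : set V)
    (f : V -> W) : Prop :=
  forall a, A a -> exists (U : set V) (F : V -> W),
    [/\ open U, U a, smooth_on U F & forall x, A x -> U x -> F x = f x].

Definition diffeomorphic (R : realType) (V W : normedModType R)
    (A : set V) (B : set W) : Prop :=
  exists (f : V -> W) (g : W -> V),
    [/\ smooth_on_subset A f, smooth_on_subset B g,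
        forall x, A x -> B (f x) /\ g (f x) = x &
        forall y, B y -> A (g y) /\ f (g y) = y].

Section SmoothStructure.
Variable R : realType.

Notation plane := (R^o * R^o)%type.

Definition unit_circle : set plane := [set p | p.1 ^+ 2 + p.2 ^+ 2 = 1].

(* The extended line carries the smooth structure of the circle of folding
   angles modulo [2 * pi], realized as the unit circle of the plane. *)
Definition circle_pt (u : ext_line R) : plane :=
  (cos (fold_angle u), sin (fold_angle u)).

Definition torus_pt (p : ext_line4 R) : plane * plane * plane * plane :=
  let: (x, y, z, w) := p in
  (circle_pt x, circle_pt y, circle_pt z, circle_pt w).

Definition diffeomorphic_to_circle (B : set (ext_line4 R)) : Prop :=
  diffeomorphic (torus_pt @` B) unit_circle.

Lemma fold_angleK (u : ext_line R) : tan_half (fold_angle u) = u.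
Proof.
case: u => [t|]; rewrite /tan_half /fold_angle; last by rewrite cos_pihalf eqxx.
rewrite mulrC mulKf ?pnatr_eq0// atanK ifF//.
by apply/negbTE; rewrite gt_eqF// cos_gt0_pihalf// atan_gtNpi2 atan_ltpi2.
Qed.

Lemma circle_pt_tan_half (theta : R) :
  circle_pt (tan_half theta) = (cos theta, sin theta).
Proof.
rewrite /circle_pt; set phi := fold_angle _.
have: tan_half phi = tan_half theta by rewrite fold_angleK.
have dbl (r : R) : r = (r / 2) *+ 2 by rewrite -mulr_natr divfK ?pnatr_eq0.
have cosd (r : R) : cos r = cos (r / 2) ^+ 2 *+ 2 - 1.
  by rewrite [in LHS](dbl r) cos_mulr2n.
have sind (r : R) : sin r = (cos (r / 2) * sin (r / 2)) *+ 2.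
  by rewrite [in LHS](dbl r) sin_mulr2n.
rewrite !(cosd phi, cosd theta, sind phi, sind theta) /tan_half.
case: eqP => [->|/eqP cphi]; case: eqP => [->|/eqP ctheta] //.
  by rewrite !mul0r.
move=> [tanE].
have cosE : cos (phi / 2) ^+ 2 = cos (theta / 2) ^+ 2.
  by apply: invr_inj; rewrite !cos2_tan2// tanE.
have sinE (r : R) : cos r != 0 -> cos r * sin r = cos r ^+ 2 * tan r.
  by move=> cr; rewrite /tan; field.
by rewrite !sinE// cosE tanE.
Qed.

End SmoothStructure.

(* Main.v *)
Require Import Defs.
From mathcomp Require Import all_boot all_order all_algebra.
From mathcomp Require Import all_classical all_reals all_analysis.
From mathcomp Require Import ring lra.
Import Order.TTheory GRing.Theory Num.Theory.
Import numFieldNormedType.Exports.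

Local Open Scope classical_set_scope.
Local Open Scope ring_scope.

Set Implicit Arguments.
Unset Strict Implicit.
Unset Printing Implicit Defensive.

(** For a cross, [rot3 a *m rot1 x *m rot3 (pi - a)] is a symmetric involution
    [cross_mx a x], so closure reads [rot1 y *m cross_mx a z = cross_mx a x *m
    rot1 (- w)].  Comparing entries gives [cos z = cos x] and [cos w = cos y],
    and the signs of the sines leave exactly the three families.  The first two
    branches are circles embedded as coordinate axes.  On the third one
    [y = - 1 / (t cos a)] makes the other coordinates rational functions of
    [(cos x, sin x)] with denominator
    [1 + c ^+ 2 + (1 - c ^+ 2) * cos x = (1 + cos x) + c ^+ 2 * (1 - cos x)],
    positive on the whole circle, so smoothness holds also at [t = 0, oo]. *)

(** * Smooth maps on open sets *)

(** The first-order expansion at [x] only involves points near [x], so it passes from [f] to [g];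
    uniqueness of the differential then identifies ['d g x]. *)
Lemma eq_on_differentiable (R : realType) (V W : normedModType R) (U : set V)
    (f g : V -> W) x :
  open U -> U x -> {in U, f =1 g} -> differentiable f x -> differentiable g x.
Proof.
move=> oU Ux fg df; have [dfc dfE] := (diff_locallyP x f).1 df.
have gE : g \o shift x = cst (g x) + 'd f x +o_ 0 id.
  apply/eqaddoP => e e0.
  have : \forall h \near 0, (f \o shift x) h = (g \o shift x) h.
    rewrite (near_shift x) sub0r.
    near=> y; rewrite /= subrK; apply: fg; rewrite inE.
    by near: y; exact: open_nbhs_nbhs.
  move/eqaddoP : dfE => /(_ e e0); apply: filterS2 => h le fgh.
  by move: le; rewrite !fctE /= -(fg x) ?inE//; rewrite /= in fgh; rewrite fgh.
have dgE : 'd g x = 'd f x :> (V -> W) by exact: diff_unique.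
by apply/diff_locallyP; rewrite dgE.
Unshelve. all: by end_near. Qed.

Lemma eq_on_derive (R : realType) (V W : normedModType R) (U : set V)
    (f g : V -> W) x v :
  open U -> U x -> {in U, f =1 g} -> 'D_v f x = 'D_v g x.
Proof.
move=> oU Ux fg; apply: near_eq_derive.
have := open_nbhs_nbhs (conj oU Ux); apply: filterS => y Uy.
by apply: fg; rewrite inE.
Qed.

(** * Stability of the class C^k under the operations that build rational maps *)

Section Ck.
Variables (R : realType) (V : normedModType R) (U : set V).
Hypothesis oU : open U.

(** [Ck_on] iterates derivatives of total functions, while derivative formulas hold only on [U].
    This lets each induction on [k] replace a derivative by its formula. *)
Lemma Ck_on_eq (W : normedModType R) k (f g : V -> W) :
  {in U, f =1 g} -> Ck_on k U f -> Ck_on k U g.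
Proof.
elim: k f g => [|k IH] f g fg /=.
  move=> cf x Ux; have cfx : f z @[z --> x] --> f x := cf x Ux.
  change (g z @[z --> x] --> g x).
  rewrite -(fg x) ?inE//; apply: cvg_trans cfx.
  apply: near_eq_cvg.
  have := open_nbhs_nbhs (conj oU Ux); apply: filterS => y Uy.
  by apply: fg; rewrite inE.
move=> [df Df]; split=> [x Ux|v].
  exact: (eq_on_differentiable oU Ux fg (df x Ux)).
apply: IH (Df v) => x; rewrite inE => Ux; exact: (eq_on_derive _ oU Ux fg).
Qed.

Lemma Ck_onS (W : normedModType R) k (f : V -> W) :
  Ck_on k.+1 U f -> Ck_on k U f.
Proof.
elim: k f => [|k IH] f /= [df Df].
  by move=> x Ux; apply: differentiable_continuous; exact: df.
by split=> // v; apply: IH; exact: Df.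
Qed.

Lemma Ck_on_cst (W : normedModType R) k (a : W) : Ck_on k U (cst a).
Proof.
elim: k a => [|k IH] a /=; first by move=> x _; exact: cst_continuous.
split=> // v; apply: Ck_on_eq (IH 0) => x _.
by rewrite derive_cst.
Qed.

Lemma Ck_on_id k : Ck_on k U (id : V -> V).
Proof.
case: k => [|k] /=; first by move=> x _; exact: cvg_id.
split=> [x _|v]; first exact: ex_diff.
by apply: Ck_on_eq (Ck_on_cst k v) => x _; rewrite derive_id.
Qed.

(** A continuous linear map commutes with directional derivatives, so the induction hypothesis
    applies to ['D_v f]. *)
Lemma Ck_on_linear_comp (W W' : normedModType R) k (L : {linear W -> W'})
    (f : V -> W) :
  continuous L -> Ck_on k U f -> Ck_on k U (L \o f).
Proof.
move=> cL; have dL := fun y => linear_differentiable y cL.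
elim: k f => [|k IH] f /=.
  by move=> cf x Ux; apply: continuous_comp; [exact: cf|exact: cL].
move=> [df Df]; split=> [x Ux|v].
  by apply: differentiable_comp; [exact: df|exact: dL].
apply: Ck_on_eq (IH _ (Df v)) => x; rewrite inE => Ux /=.
have dfx := df _ Ux.
rewrite !deriveE//; last exact: differentiable_comp.
by rewrite (diff_comp dfx (dL (f x))) /= diff_lin.
Qed.

Lemma Ck_on_fst (W W' : normedModType R) k (f : V -> W * W') :
  Ck_on k U f -> Ck_on k U (fst \o f).
Proof. by apply: Ck_on_linear_comp => x; exact: cvg_fst. Qed.

Lemma Ck_on_snd (W W' : normedModType R) k (f : V -> W * W') :
  Ck_on k U f -> Ck_on k U (snd \o f).
Proof. by apply: Ck_on_linear_comp => x; exact: cvg_snd. Qed.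

Lemma Ck_onD (W : normedModType R) k (f g : V -> W) :
  Ck_on k U f -> Ck_on k U g -> Ck_on k U (f \+ g).
Proof.
elim: k f g => [|k IH] f g /=.
  by move=> cf cg x Ux; apply: cvgD; [exact: cf|exact: cg].
move=> [df Df] [dg Dg]; split=> [x Ux|v].
  by apply: differentiableD; [exact: df|exact: dg].
apply: Ck_on_eq (IH _ _ (Df v) (Dg v)) => x; rewrite inE => Ux /=.
by rewrite deriveD//; apply: diff_derivable; [exact: df|exact: dg].
Qed.

Lemma Ck_on_pair (W W' : normedModType R) k (f : V -> W) (g : V -> W') :
  Ck_on k U f -> Ck_on k U g -> Ck_on k U (fun x => (f x, g x)).
Proof.
elim: k f g => [|k IH] f g /=.
  by move=> cf cg x Ux; apply: cvg_pair; [exact: cf|exact: cg].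
move=> [df Df] [dg Dg]; split=> [x Ux|v].
  by apply: differentiable_pair; [exact: df|exact: dg].
apply: Ck_on_eq (IH _ _ (Df v) (Dg v)) => x; rewrite inE => Ux /=.
have dfx := df _ Ux; have dgx := dg _ Ux.
rewrite !deriveE//; last exact: differentiable_pair.
by rewrite diff_pair.
Qed.

(** Leibniz rule: in each product the undifferentiated factor is lowered one class by [Ck_onS], and
    the induction hypothesis applies. *)
Lemma Ck_onM k (f g : V -> R^o) :
  Ck_on k U f -> Ck_on k U g -> Ck_on k U (f \* g : V -> R^o).
Proof.
elim: k f g => [|k IH] f g.
  by move=> cf cg x Ux; apply: cvgM; [exact: cf|exact: cg].
move=> Cf Cg; have [[df Df] [dg Dg]] := (Cf, Cg); split=> [x Ux|v].
  by apply: differentiableM; [exact: df|exact: dg].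
have CC := Ck_onD (IH _ _ (Ck_onS Cf) (Dg v)) (IH _ _ (Ck_onS Cg) (Df v)).
apply: Ck_on_eq CC => x; rewrite inE => Ux /=.
by rewrite deriveM//; apply: diff_derivable; [exact: df|exact: dg].
Qed.

(** The derivative [-1 * (f^-1 * f^-1 * 'D_v f)] contains [f^-1] itself, which is C^k by
    induction. *)
Lemma Ck_onV k (f : V -> R^o) : (forall x, U x -> f x != 0) ->
  Ck_on k U f -> Ck_on k U ((fun x => (f x)^-1) : V -> R^o).
Proof.
move=> f0; elim: k => [|k IH].
  by move=> cf x Ux; apply: cvgV; [exact: f0|exact: cf].
move=> Cf; have [df Df] := Cf; split=> [x Ux|v].
  by apply: differentiableV; [exact: df|exact: f0].
have Cf' := IH (Ck_onS Cf).
have CC := Ck_onM (Ck_on_cst (W := R^o) k (-1))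
  (Ck_onM (Ck_onM Cf' Cf') (Df v)).
apply: Ck_on_eq CC => x; rewrite inE => Ux /=.
rewrite deriveV//; [|exact: f0|by apply: diff_derivable; exact: df].
by rewrite expr2 invfM mulN1r -mulNr.
Qed.

End Ck.

(** * Half-angle coordinates *)

Section ExtendedLineFacts.
Variable R : realType.
Implicit Types (t theta : R) (u : ext_line R).

Lemma circle_pt_None : circle_pt (None : ext_line R) = (-1, 0).
Proof. by rewrite /circle_pt /fold_angle cospi sinpi. Qed.

(** Rational parametrization of the circle, from the double-angle formulas and
    [cos a ^+ 2 = (1 + t ^+ 2)^-1]. *)
Lemma circle_pt_Some t :
  circle_pt (Some t : ext_line R) =
  ((1 - t ^+ 2) / (1 + t ^+ 2), 2 * t / (1 + t ^+ 2)).
Proof.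
rewrite /circle_pt /fold_angle; set a := atan t.
have ca : cos a != 0.
  by rewrite gt_eqF// cos_gt0_pihalf// atan_gtNpi2 atan_ltpi2.
have t1 : 1 + t ^+ 2 != 0 by rewrite gt_eqF// ltr_pwDl// sqr_ge0.
have c2 : cos a ^+ 2 = (1 + t ^+ 2)^-1.
  by rewrite -[t]atanK -cos2_tan2// invrK.
have csE : cos a * sin a = t / (1 + t ^+ 2).
  by rewrite -c2 -[t]atanK -/a /tan; field.
have -> : 2 * a = a *+ 2 by rewrite mulr_natl.
rewrite cos_mulr2n sin_mulr2n csE c2; congr pair; first by field.
by rewrite -mulr_natl mulrA.
Qed.

(** Removes the half angle: only the cosine and sine of [theta], the quantities in the closure
    matrices, remain. *)
Lemma tan_halfE theta : tan_half theta =
  if cos theta == -1 then None else Some (sin theta / (1 + cos theta)).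
Proof.
have := circle_pt_tan_half theta.
case: (tan_half theta) => [t|].
  rewrite circle_pt_Some => -[<- <-].
  have t1 : 1 + t ^+ 2 != 0 by rewrite gt_eqF// ltr_pwDl// sqr_ge0.
  have -> : 1 + (1 - t ^+ 2) / (1 + t ^+ 2) = 2 / (1 + t ^+ 2) by field.
  rewrite ifF; first by congr Some; field.
  apply/negbTE/eqP => /(congr1 ( *%R^~ (1 + t ^+ 2))); rewrite divfK//; lra.
by rewrite circle_pt_None => -[<- _]; rewrite eqxx.
Qed.

Lemma eq_tan_half theta phi :
  cos theta = cos phi -> sin theta = sin phi -> tan_half theta = tan_half phi.
Proof. by rewrite !tan_halfE => -> ->. Qed.

Lemma circle_pt_unit u : unit_circle (circle_pt u).
Proof. exact: cos2Dsin2. Qed.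

(** Stereographic projection from [(-1, 0)]: the slope [S / (1 + C)] is the parameter of every other
    point, and [(-1, 0)] comes from infinity. *)
Lemma unit_circle_pt (p : R^o * R^o) :
  unit_circle p -> exists u, p = circle_pt u.
Proof.
case: p => C S; rewrite /unit_circle /= => CS.
have [C1|C1] := eqVneq C (-1).
  exists None; rewrite circle_pt_None C1; congr pair.
  apply/eqP; rewrite -sqrf_eq0; apply/eqP.
  by rewrite C1 in CS; nra.
have D0 : 1 + C != 0 by apply: contraNneq C1 => D0; apply/eqP; lra.
have S2 : S ^+ 2 = (1 - C) * (1 + C) by lra.
exists (Some (S / (1 + C))); rewrite circle_pt_Some expr_div_n S2.
have E : 1 + (1 - C) * (1 + C) / (1 + C) ^+ 2 = 2 / (1 + C) by field.
by rewrite E; congr pair; field.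
Qed.

End ExtendedLineFacts.

(** * The closure condition of a cross *)

Section CrossMatrix.
Variable R : realType.
Implicit Types (a x y z w : R).

(* [rot3 a *m rot1 x *m rot3 (pi - a)], with [sin a ^+ 2] eliminated *)
Definition cross_mx a x : 'M[R]_3 :=
  \matrix_(i < 3, j < 3)
    nth 0 (nth [::]
      [:: [:: - (cos a ^+ 2 + (1 - cos a ^+ 2) * cos x);
              - (cos a * sin a * (1 - cos x)); sin a * sin x];
          [:: - (cos a * sin a * (1 - cos x));
              - (1 - cos a ^+ 2 + cos a ^+ 2 * cos x); - (cos a * sin x)];
          [:: sin a * sin x; - (cos a * sin x); cos x]] i) j.

Lemma cross_mxE a x : rot3 a *m rot1 x *m rot3 (pi - a) = cross_mx a x.
Proof.
have s2 : sin a ^+ 2 = 1 - cos a ^+ 2 by rewrite sin2cos2.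
apply/matrixP => i j; rewrite !mxE !big_ord_recl big_ord0 !mxE.
rewrite !big_ord_recl !big_ord0 !mxE /=.
rewrite cosB sinB cospi sinpi.
case: i => [[|[|[|//]]] ?]; case: j => [[|[|[|//]]] ?] /=;
  ring: s2.
Qed.

(** Geometrically this is a half-turn: a rotation about a horizontal axis times the half-turn about
    the third axis, which conjugates that rotation into its inverse. *)
Lemma cross_mxK a x : cross_mx a x *m cross_mx a x = 1%:M.
Proof.
have s2 : sin a ^+ 2 = 1 - cos a ^+ 2 by rewrite sin2cos2.
have x2 : sin x ^+ 2 = 1 - cos x ^+ 2 by rewrite sin2cos2.
apply/matrixP => i j; rewrite !mxE !big_ord_recl big_ord0 !mxE /=.
case: i => [[|[|[|//]]] ?]; case: j => [[|[|[|//]]] ?] /=;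
  ring: s2 x2.
Qed.

Lemma rot1N x : rot1 x *m rot1 (- x) = 1%:M.
Proof.
have x2 : sin x ^+ 2 = 1 - cos x ^+ 2 by rewrite sin2cos2.
apply/matrixP => i j; rewrite !mxE !big_ord_recl big_ord0 !mxE /= cosN sinN.
case: i => [[|[|[|//]]] ?]; case: j => [[|[|[|//]]] ?] /=;
  ring: x2.
Qed.

Lemma closure_crossP a x y z w :
  closure_condition a (pi - a) a (pi - a) x y z w <->
  rot1 y *m cross_mx a z = cross_mx a x *m rot1 (- w).
Proof.
have wK : rot1 (- w) *m rot1 w = 1%:M by rewrite -{2}[w]opprK rot1N.
rewrite /closure_condition.
have -> : rot3 a *m rot1 x *m rot3 (pi - a) *m rot1 y *m rot3 a *m rot1 z *m
    rot3 (pi - a) *m rot1 w =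
    cross_mx a x *m (rot1 y *m cross_mx a z) *m rot1 w.
  by rewrite -!cross_mxE !mulmxA.
split=> [E|->]; last by rewrite mulmxA cross_mxK mul1mx.
transitivity (cross_mx a x *m (cross_mx a x *m (rot1 y *m cross_mx a z) *m
  rot1 w) *m rot1 (- w)); last by rewrite E mulmx1.
by rewrite -!mulmxA rot1N mulmx1 !mulmxA cross_mxK mul1mx.
Qed.

End CrossMatrix.

(** Six entries of the closure equation, with cosines and sines as field elements on unit circles.
    The alternatives are, in order, the second, first and third branch; since [(1 - Cx) / Sx] is the
    half-tangent, the relation in the last one says that [c] times the half-tangents of [x] and [y]
    is [-1]. *)
Lemma cross_angles (R : realFieldType) (c s Cx Sx Cy Sy Cz Sz Cw Sw : R) :
  c != 0 -> s != 0 -> c ^+ 2 + s ^+ 2 = 1 ->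
  Cx ^+ 2 + Sx ^+ 2 = 1 -> Cy ^+ 2 + Sy ^+ 2 = 1 ->
  Cz ^+ 2 + Sz ^+ 2 = 1 -> Cw ^+ 2 + Sw ^+ 2 = 1 ->
  - (c ^+ 2 + (1 - c ^+ 2) * Cz) = - (c ^+ 2 + (1 - c ^+ 2) * Cx) ->
  - (c * s * (1 - Cz)) = - (c * s * (1 - Cx)) * Cw + s * Sx * - Sw ->
  - (c * s * (1 - Cx)) = Cy * - (c * s * (1 - Cz)) + - Sy * (s * Sz) ->
  s * Sz = - (c * s * (1 - Cx)) * Sw + s * Sx * Cw ->
  Cy * - (1 - c ^+ 2 + c ^+ 2 * Cz) + - Sy * - (c * Sz) =
    - (1 - c ^+ 2 + c ^+ 2 * Cx) * Cw + - (c * Sx) * - Sw ->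
  Cy * - (c * Sz) + - Sy * Cz =
    - (1 - c ^+ 2 + c ^+ 2 * Cx) * Sw + - (c * Sx) * Cw ->
  [\/ [/\ Cx = 1, Sx = 0, Cz = 1, Sz = 0 & Cw = Cy /\ Sw = Sy],
      [/\ Cy = 1, Sy = 0, Cw = 1, Sw = 0 & Cz = Cx /\ Sz = Sx] |
      [/\ Cx != 1, Cy != 1, c * (1 - Cx) * (1 - Cy) = - (Sx * Sy) &
          [/\ Cz = Cx, Sz = - Sx, Cw = Cy & Sw = - Sy]]].
Proof.
move=> c0 s0 cs X Y Z W e11 e12 e21 e13 e22 e23.
have CzE : Cz = Cx.
  apply: (mulfI (expf_neq0 2 s0)).
  by have -> : s ^+ 2 = 1 - c ^+ 2 by [rewrite -cs; ring]; lra.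
subst Cz.
have a12 : c * (1 - Cx) * (1 - Cw) = Sw * Sx by apply: (mulfI s0); lra.
have a21 : c * (1 - Cx) * (1 - Cy) = Sy * Sz by apply: (mulfI s0); lra.
have a13 : Sz = Cw * Sx - c * (1 - Cx) * Sw by apply: (mulfI s0); lra.
have CwE : Cw = Cy.
  have b1 : c * (Sw * Sx) = c * (c * (1 - Cx) * (1 - Cw)) by rewrite a12.
  have b2 : c * (Sy * Sz) = c * (c * (1 - Cx) * (1 - Cy)) by rewrite a21.
  lra.
subst Cw.
have [Cx1|Cx1] := eqVneq Cx 1.
  subst Cx; constructor 1.
  have Sx0 : Sx = 0 by apply/eqP; rewrite -sqrf_eq0; apply/eqP; lra.
  have Sz0 : Sz = 0 by apply/eqP; rewrite -sqrf_eq0; apply/eqP; lra.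
  by subst; split=> //; split=> //; lra.
have Cx1' : 1 - Cx != 0 by rewrite subr_eq0 eq_sym.
have [Cy1|Cy1] := eqVneq Cy 1.
  subst Cy; constructor 2.
  have Sy0 : Sy = 0 by apply/eqP; rewrite -sqrf_eq0; apply/eqP; lra.
  have Sw0 : Sw = 0 by apply/eqP; rewrite -sqrf_eq0; apply/eqP; lra.
  by subst; split=> //; split=> //; lra.
have Cy1' : 1 - Cy != 0 by rewrite subr_eq0 eq_sym.
have SwSx : Sw * Sx != 0 by rewrite -a12 !mulf_neq0.
move: (SwSx); rewrite mulf_eq0 negb_or => /andP[Sw0 Sx0].
have : Sz ^+ 2 == Sx ^+ 2 by apply/eqP; lra.
rewrite eqf_sqr => /orP[/eqP SzE|/eqP SzE];
  rewrite SzE in a21 a13 *.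
  (* The sign [Sz = Sx] is impossible: [a13] gives [Sx * (1 - Cy) = - (c * (1 - Cx) * Sw)], and with
     [a12] this forces [(1 - Cy) ^+ 2 + Sw ^+ 2 = 0]. *)
  have k0 : c * (1 - Cx) != 0 by rewrite mulf_neq0.
  have Sw2 : 0 < Sw ^+ 2 by rewrite exprn_even_gt0.
  have : (1 - Cy) ^+ 2 + Sw ^+ 2 = 0.
    apply: (mulfI k0); rewrite mulrDr mulr0 {1}expr2 mulrA a12.
    by rewrite -mulrA (_ : Sx * (1 - Cy) = - (c * (1 - Cx) * Sw)); [ring|lra].
  have := sqr_ge0 (1 - Cy); lra.
have SwE : Sw = - Sy by apply: (mulIf Sx0) => /=; lra.
by constructor 3; split=> //; rewrite a12 SwE; ring.
Qed.

(** * The configuration space as the union of the three branches *)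

Section CrossConfigurations.
Variables (R : realType) (a : R).
Hypothesis (a_range : 0 < a < pi) (a_cross : a <> pi / 2).

Let c := cos a.
Let s := sin a.

Lemma cross_sin_neq0 : s != 0.
Proof. by rewrite gt_eqF// sin_gt0_pi. Qed.

Lemma cross_cos_neq0 : c != 0.
Proof.
apply/eqP => c0; apply: a_cross; case/andP: a_range => a0 api.
apply: cos_inj; last by rewrite cos_pihalf.
  by rewrite in_itv /= !ltW.
by rewrite in_itv /= divr_ge0 ?pi_ge0// ler_pdivrMr// ler_peMr ?pi_ge0 ?ler1n.
Qed.

Let c0 := cross_cos_neq0.
Let s0 := cross_sin_neq0.

Lemma branch1_closure x : closure_condition a (pi - a) a (pi - a) x 0 x 0.
Proof.
have r0 : rot1 0 = 1%:M :> 'M[R]_3.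
  apply/matrixP => i j; rewrite !mxE cos0 sin0 oppr0.
  by case: i => [[|[|[|//]]] ?]; case: j => [[|[|[|//]]] ?].
by apply/closure_crossP; rewrite oppr0 r0 mul1mx mulmx1.
Qed.

Lemma branch2_closure y : closure_condition a (pi - a) a (pi - a) 0 y 0 y.
Proof.
apply/closure_crossP; apply/matrixP => i j.
rewrite !mxE !big_ord_recl !big_ord0 !mxE /= cosN sinN cos0 sin0.
case: i => [[|[|[|//]]] ?]; case: j => [[|[|[|//]]] ?] /=; ring.
Qed.

(** For finite nonzero [t] all cosines and sines are rational in [t], so closure is a field identity
    in each entry. *)
Lemma branch3_closure t x y z w : t != 0 ->
  tan_half x = Some t -> tan_half y = Some (-1 / (c * t)) ->
  tan_half z = Some (- t) -> tan_half w = Some (1 / (c * t)) ->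
  closure_condition a (pi - a) a (pi - a) x y z w.
Proof.
move=> t0 xE yE zE wE.
have ct0 : c * t != 0 by rewrite mulf_neq0.
have t1 : 1 + t ^+ 2 != 0 by rewrite gt_eqF// ltr_pwDl// sqr_ge0.
have ct1 : 1 + (c * t) ^+ 2 != 0 by rewrite gt_eqF// ltr_pwDl// sqr_ge0.
have cs2 : sin a ^+ 2 = 1 - cos a ^+ 2 by rewrite sin2cos2.
apply/closure_crossP; apply/matrixP => i j.
rewrite !mxE !big_ord_recl !big_ord0 !mxE /= cosN sinN.
(* Clearing the nested fractions leaves [1 + t ^+ 2] and [1 + (c * t) ^+ 2] as the only denominators
   in the entries. *)
have cy : ((1 - (-1 / (c * t)) ^+ 2) / (1 + (-1 / (c * t)) ^+ 2) =
    ((c * t) ^+ 2 - 1) / (1 + (c * t) ^+ 2)) *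
  (2 * (-1 / (c * t)) / (1 + (-1 / (c * t)) ^+ 2) =
    - (2 * (c * t) / (1 + (c * t) ^+ 2))).
  by split; field; rewrite ct1 t0 c0.
have cw : ((1 - (1 / (c * t)) ^+ 2) / (1 + (1 / (c * t)) ^+ 2) =
    ((c * t) ^+ 2 - 1) / (1 + (c * t) ^+ 2)) *
  (2 * (1 / (c * t)) / (1 + (1 / (c * t)) ^+ 2) =
    2 * (c * t) / (1 + (c * t) ^+ 2)).
  by split; field; rewrite ct1 t0 c0.
have := circle_pt_tan_half x; rewrite xE circle_pt_Some => -[<- <-].
have := circle_pt_tan_half y; rewrite yE circle_pt_Some cy.1 cy.2 => -[<- <-].
have := circle_pt_tan_half z; rewrite zE circle_pt_Some sqrrN => -[<- <-].
have := circle_pt_tan_half w; rewrite wE circle_pt_Some cw.1 cw.2 => -[<- <-].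
rewrite -/c -/s in cs2 *.
case: i => [[|[|[|//]]] ?]; case: j => [[|[|[|//]]] ?] /=;
  by field; rewrite ?ct1 ?t1.
Qed.

Lemma closure_cross_branches x y z w :
  closure_condition a (pi - a) a (pi - a) x y z w ->
  [\/ branch1 R (tan_half x, tan_half y, tan_half z, tan_half w),
      branch2 R (tan_half x, tan_half y, tan_half z, tan_half w) |
      branch3 a (tan_half x, tan_half y, tan_half z, tan_half w)].
Proof.
move=> /closure_crossP/matrixP E.
pose o k h : 'I_3 := @Ordinal 3 k h.
have e11 := E (o 0 isT) (o 0 isT); have e12 := E (o 0 isT) (o 1 isT).
have e21 := E (o 1 isT) (o 0 isT); have e13 := E (o 0 isT) (o 2 isT).
have e22 := E (o 1 isT) (o 1 isT); have e23 := E (o 1 isT) (o 2 isT).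
rewrite !mxE !big_ord_recl !big_ord0 !mxE /= ?cosN ?sinN
  in e11 e12 e21 e13 e22 e23.
rewrite ?mul1r ?mul0r ?mulr1 ?mulr0 ?addr0 ?add0r ?opprK
  in e11 e12 e21 e13 e22 e23.
have th0 (u : R) : cos u = 1 -> sin u = 0 -> tan_half u = Some 0 :> ext_line R.
  move=> u1 u0; rewrite tan_halfE u1 u0 mul0r ifF//.
  by apply/negbTE/eqP; lra.
have := cross_angles c0 s0 (cos2Dsin2 a) (cos2Dsin2 x) (cos2Dsin2 y)
  (cos2Dsin2 z) (cos2Dsin2 w).
rewrite /c /s; case=> //.
- move=> [x1 x0 z1 z0 [wc ws]]; constructor 2; exists (tan_half y).
  by rewrite (th0 x)// (th0 z)// (eq_tan_half wc ws).
- move=> [y1 y0 w1 w0 [zc zs]]; constructor 1; exists (tan_half x).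
  by rewrite (th0 y)// (th0 w)// (eq_tan_half zc zs).
move=> [x1 y1 xyE [zc zs wc ws]]; constructor 3; exists (tan_half x).
have zNx : tan_half z = ext_opp (tan_half x).
  by rewrite !tan_halfE zc zs; case: ifP => //= _; rewrite mulNr.
have x1' : 1 - cos x != 0 by rewrite subr_eq0 eq_sym.
have y1' : 1 - cos y != 0 by rewrite subr_eq0 eq_sym.
(* Nonzero sines exclude the angles 0 and pi, so the half-tangents are finite and nonzero; the
   points [t = 0] and infinity of the third branch arise in the first two cases. *)
have : sin x * sin y != 0.
  by rewrite -oppr_eq0 -xyE !mulf_neq0.
rewrite mulf_eq0 negb_or => /andP[x0 y0].
have N1 (u : R) : sin u != 0 -> 1 + cos u != 0.
  apply: contraNneq => u1; rewrite -sqrf_eq0 sin2cos2.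
  by apply/eqP; rewrite (_ : cos u = -1); [ring|lra].
have hx := N1 x x0; have hy := N1 y y0.
have ifN (u : R) : 1 + cos u != 0 -> (cos u == -1) = false.
  by move=> u1; apply/negbTE; apply: contraNneq u1 => ->; apply/eqP; ring.
have t0 : c * (sin x / (1 + cos x)) != 0 by rewrite !mulf_neq0 ?invr_neq0.
have key : sin y / (1 + cos y) * (c * (sin x / (1 + cos x))) = -1.
  have x2 := sin2cos2 x; have y2 := sin2cos2 y.
  (* Multiplying by [(1 - cos x) * (1 - cos y)] makes [xyE] applicable, and
     [(1 - cos u) * (1 + cos u) = sin u ^+ 2] finishes. *)
  have k : c * sin x * sin y = - ((1 + cos x) * (1 + cos y)).
    apply: (mulfI (mulf_neq0 x1' y1')).
    have -> : (1 - cos x) * (1 - cos y) * (c * sin x * sin y) =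
       c * (1 - cos x) * (1 - cos y) * (sin x * sin y) by ring.
    by rewrite xyE; ring: x2 y2.
  have -> : sin y / (1 + cos y) * (c * (sin x / (1 + cos x))) =
    c * sin x * sin y / ((1 + cos x) * (1 + cos y)) by field; rewrite hx hy.
  by rewrite k mulNr divff// mulf_neq0.
rewrite zNx; congr (_, _, _, _).
  rewrite !tan_halfE !ifN//= (negbTE t0); congr Some.
  exact: (canRL (mulfK t0)).
rewrite tan_halfE wc ws tan_halfE !ifN//= (negbTE t0); congr Some.
by apply: (canRL (mulfK t0)); rewrite 2!mulNr key opprK.
Qed.

Lemma cross_config_space : config_space a (pi - a) a (pi - a) =
  branch1 R `|` branch2 R `|` branch3 a.
Proof.
have th0 : tan_half 0 = Some 0 :> ext_line R.
  by rewrite tan_halfE sin0 mul0r ifF// cos0; apply/negbTE/eqP; lra.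
have b1 t : config_space a (pi - a) a (pi - a) (t, Some 0, t, Some 0).
  exists (fold_angle t), 0, (fold_angle t), 0; split.
    exact: branch1_closure.
  by rewrite fold_angleK th0.
have b2 t : config_space a (pi - a) a (pi - a) (Some 0, t, Some 0, t).
  exists 0, (fold_angle t), 0, (fold_angle t); split.
    exact: branch2_closure.
  by rewrite fold_angleK th0.
apply/seteqP; split=> p.
  move=> [x [y [z [w [/closure_cross_branches + ->]]]]].
  by case; [left; left|left; right|right].
(* The third branch meets the first at [t] infinite and the second at [t = 0]; these two points are
   covered by [b1] and [b2]. *)
case=> [[|] [t ->]//|[[t|] ->]]; last exact: b1.
rewrite /= mulf_eq0 (negbTE c0) /=.
have [->|t0] := eqVneq t 0; first by rewrite oppr0; exact: b2.
exists (fold_angle (Some t)), (fold_angle (Some (-1 / (c * t)))),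
  (fold_angle (Some (- t))), (fold_angle (Some (1 / (c * t)))).
split; last by rewrite !fold_angleK.
by apply: (branch3_closure t0); rewrite fold_angleK.
Qed.

End CrossConfigurations.

(** * Smooth parametrizations of the branches *)

Section CircleBranches.
Variable R : realType.
Notation plane := (R^o * R^o)%type.
Implicit Types u : ext_line R.

(** When a globally smooth [pr] is a left inverse of [g], it serves as the inverse diffeomorphism;
    only smoothness of [g] near the circle is left to check. *)
Lemma diffeomorphic_to_circle_range (h : ext_line R -> ext_line4 R)
    (pr : plane * plane * plane * plane -> plane)
    (g : plane -> plane * plane * plane * plane) (D : set plane) :
  smooth_on setT pr -> open D -> @unit_circle R `<=` D -> smooth_on D g ->
  cancel g pr -> (forall u, torus_pt (h u) = g (circle_pt u)) ->
  diffeomorphic_to_circle [set p | exists u, p = h u].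
Proof.
move=> spr oD sub sg gK hg; exists pr, g; split.
- by move=> x _; exists setT, pr; split=> //; exact: openT.
- by move=> x /sub Dx; exists D, g.
- by move=> _ [_ [u ->] <-]; rewrite hg gK; split=> //; exact: circle_pt_unit.
move=> y /unit_circle_pt[u ->]; split; last exact: gK.
by exists (h u); [exists u|rewrite hg].
Qed.

Lemma circle_pt_Some0 : circle_pt (Some 0 : ext_line R) = (1, 0).
Proof. by rewrite circle_pt_Some expr0n /= subr0 addr0 divr1 mulr0 mul0r. Qed.

Lemma smooth_on_proj1 :
  smooth_on setT (fun q : plane * plane * plane * plane => q.1.1.1).
Proof.
move=> k; have oT := @openT (plane * plane * plane * plane)%type.
exact: (Ck_on_fst oT (Ck_on_fst oT (Ck_on_fst oT (Ck_on_id oT k)))).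
Qed.

(** Serves the second branch, whose first coordinate is constant. *)
Lemma smooth_on_proj2 :
  smooth_on setT (fun q : plane * plane * plane * plane => q.1.1.2).
Proof.
move=> k; have oT := @openT (plane * plane * plane * plane)%type.
exact: (Ck_on_snd oT (Ck_on_fst oT (Ck_on_fst oT (Ck_on_id oT k)))).
Qed.

Lemma branch1_circle : diffeomorphic_to_circle (branch1 R).
Proof.
apply: (@diffeomorphic_to_circle_range (fun u => (u, Some 0, u, Some 0)) _
  (fun p => (p, (1, 0), p, (1, 0))) setT smooth_on_proj1 openT) => //.
  move=> k; have oT := @openT plane.
  by do !apply: (Ck_on_pair oT);
    do ?[exact: (Ck_on_id oT)|exact: (Ck_on_cst oT)].
by move=> u; rewrite /torus_pt circle_pt_Some0.
Qed.

Lemma branch2_circle : diffeomorphic_to_circle (branch2 R).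
Proof.
apply: (@diffeomorphic_to_circle_range (fun u => (Some 0, u, Some 0, u)) _
  (fun p => ((1, 0), p, (1, 0), p)) setT smooth_on_proj2 openT) => //.
  move=> k; have oT := @openT plane.
  by do !apply: (Ck_on_pair oT);
    do ?[exact: (Ck_on_id oT)|exact: (Ck_on_cst oT)].
by move=> u; rewrite /torus_pt circle_pt_Some0.
Qed.

(** * The third branch as a rational image of the circle *)

Section Branch3.
Variable a : R.
Hypothesis c0 : cos a != 0.
Let c := cos a.

(* Cosine and sine of the folding angle with half-tangent [1 / (c * t)], as
   functions of [p = circle_pt t]. *)
Definition half_cot_den (p : plane) : R^o := 1 + c ^+ 2 + (1 - c ^+ 2) * p.1.

Definition half_cot_cos (p : plane) : R^o :=
  (c ^+ 2 - 1 + - (1 + c ^+ 2) * p.1) * (half_cot_den p)^-1.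

Definition half_cot_sin (p : plane) : R^o := 2 * c * p.2 * (half_cot_den p)^-1.

(** Opposites are written [-1 * _] so that [Ck_onM] with a constant factor covers them. *)
Definition branch3_map (p : plane) : plane * plane * plane * plane :=
  (p, (half_cot_cos p, -1 * half_cot_sin p), (p.1, -1 * p.2),
   (half_cot_cos p, half_cot_sin p)).

Lemma Ck_on_half_cot_den k D : open D -> Ck_on k D half_cot_den.
Proof.
move=> oD; apply: (Ck_onD oD); first exact: (Ck_on_cst oD).
by apply: (Ck_onM oD);
    [exact: (Ck_on_cst oD)|exact: (Ck_on_fst oD (Ck_on_id oD k))].
Qed.

Lemma open_half_cot_den : open [set p | half_cot_den p != 0].
Proof.
rewrite (_ : mkset _ = half_cot_den @^-1` [set x | x != 0]) //.
apply: open_comp; last exact: open_neq.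
by move=> x _; exact: (Ck_on_half_cot_den 0 openT).
Qed.

Lemma half_cot_den_neq0 (p : plane) : unit_circle p -> half_cot_den p != 0.
Proof.
have den0 (C S : R) : C ^+ 2 + S ^+ 2 = 1 -> 0 < 1 + c ^+ 2 + (1 - c ^+ 2) * C.
  move=> CS; have c2 : 0 < c ^+ 2 by rewrite exprn_even_gt0.
  have : `|C| <= 1.
    by rewrite -(expr_le1 (n := 2))// real_normK ?num_real// -CS lerDl sqr_ge0.
  rewrite ler_norml => /andP[C1 C2].
  have cC : 0 <= c ^+ 2 * (1 - C) by rewrite mulr_ge0 ?subr_ge0// ltW.
  (* For [C > -1] the term [1 + C] is positive; at [C = -1] positivity comes from [c ^+ 2] alone. *)
  have [Cm|Cm] := ltP (-1) C; first lra.
  have -> : C = -1 by lra.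
  lra.
by case: p => C S /den0 /gt_eqF/negbT.
Qed.

Lemma smooth_on_branch3_map :
  smooth_on [set p | half_cot_den p != 0] branch3_map.
Proof.
move=> k; set D := mkset _; have oD : open D := open_half_cot_den.
have Ci : Ck_on k D (fun p => (half_cot_den p)^-1).
  by apply: (Ck_onV oD); [move=> x|exact: Ck_on_half_cot_den].
have Cc : Ck_on k D half_cot_cos.
  apply: (Ck_onM oD) Ci; apply: (Ck_onD oD); first exact: (Ck_on_cst oD).
  by apply: (Ck_onM oD);
    [exact: (Ck_on_cst oD)|exact: (Ck_on_fst oD (Ck_on_id oD k))].
have Cs : Ck_on k D half_cot_sin.
  apply: (Ck_onM oD) Ci.
  by apply: (Ck_onM oD);
    [exact: (Ck_on_cst oD)|exact: (Ck_on_snd oD (Ck_on_id oD k))].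
have CN (f : plane -> R^o) : Ck_on k D f -> Ck_on k D (fun p => -1 * f p).
  by move=> Cf; apply: (Ck_onM oD) Cf; exact: (Ck_on_cst oD).
apply: (Ck_on_pair oD); last exact: (Ck_on_pair oD).
apply: (Ck_on_pair oD).
  apply: (Ck_on_pair oD); first exact: (Ck_on_id oD).
  by apply: (Ck_on_pair oD) => //; exact: CN.
by apply: (Ck_on_pair oD); [exact: (Ck_on_fst oD (Ck_on_id oD k))|
  apply: CN; exact: (Ck_on_snd oD (Ck_on_id oD k))].
Qed.

(** One rational formula in the circle point covers the three cases of [ext_div]; its denominator is
    [2 * c ^+ 2] at infinity and 2 at [t = 0]. *)
Lemma torus_pt_branch3 u :
  torus_pt (u, ext_div (-1) (ext_scale c u), ext_opp u,
            ext_div 1 (ext_scale c u)) = branch3_map (circle_pt u).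
Proof.
case: u => [t|]; last first.
  rewrite circle_pt_None /branch3_map /half_cot_cos /half_cot_sin /half_cot_den.
  rewrite /= circle_pt_Some0 circle_pt_None.
  have -> : 1 + c ^+ 2 + (1 - c ^+ 2) * -1 = 2 * c ^+ 2 by ring.
  by congr (_, (_, _), (_, _), (_, _)); field; rewrite ?c0.
have [->|t0] := eqVneq t 0.
  rewrite circle_pt_Some0 /branch3_map.
  rewrite /half_cot_cos /half_cot_sin /half_cot_den.
  rewrite /= mulr0 eqxx oppr0 circle_pt_Some0 circle_pt_None.
  have -> : 1 + c ^+ 2 + (1 - c ^+ 2) * 1 = 2 by ring.
  by congr (_, (_, _), (_, _), (_, _)); field.
have t1 : 1 + t ^+ 2 != 0 by rewrite gt_eqF// ltr_pwDl// sqr_ge0.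
have ct1 : 1 + (c * t) ^+ 2 != 0 by rewrite gt_eqF// ltr_pwDl// sqr_ge0.
rewrite circle_pt_Some /branch3_map /half_cot_cos /half_cot_sin /half_cot_den.
rewrite /= mulf_eq0 (negbTE c0) (negbTE t0) /= !circle_pt_Some.
have -> : 1 + c ^+ 2 + (1 - c ^+ 2) * ((1 - t ^+ 2) / (1 + t ^+ 2)) =
    2 * (1 + (c * t) ^+ 2) / (1 + t ^+ 2) by field.
by congr (_, (_, _), (_, _), (_, _)); field; rewrite ?c0 ?t0 ?t1 ?ct1.
Qed.

Lemma branch3_circle : diffeomorphic_to_circle (branch3 a).
Proof.
apply: (diffeomorphic_to_circle_range smooth_on_proj1 open_half_cot_den
  half_cot_den_neq0 smooth_on_branch3_map _ torus_pt_branch3).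
by move=> p.
Qed.

End Branch3.

End CircleBranches.

Theorem mainTheorem4 (R : realType) (alpha beta gamma delta : R)
  (halpha : 0 < alpha < pi) (hbeta : 0 < beta < pi)
  (hgamma : 0 < gamma < pi) (hdelta : 0 < delta < pi)
  (hab : alpha = pi - beta) (hag : alpha = gamma) (had : alpha = pi - delta)
  (hcross : alpha <> pi / 2) :
  [/\ config_space alpha beta gamma delta =
        branch1 R `|` branch2 R `|` branch3 alpha,
      diffeomorphic_to_circle (branch1 R),
      diffeomorphic_to_circle (branch2 R) &
      diffeomorphic_to_circle (branch3 alpha)].
Proof.
have betaE : beta = pi - alpha by lra.
have deltaE : delta = pi - alpha by lra.
subst beta gamma delta; split.
- exact: cross_config_space.
- exact: branch1_circle.
- exact: branch2_circle.
- exact: branch3_circle (cross_cos_neq0 halpha hcross).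
Qed.
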